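(* There exist sequences $(G_n)_{n\in\mathbb{N}}$ of finite non-nilpotent groups such that $\sigma_1(G_n)\searrow 2$ as $n\rightarrow\infty$, i.e. the sequence of real numbers $(\sigma_1(G_n))_{n\in\mathbb{N}}$ is decreasing and converges to $2$.
   Context: For a finite group $G$, let $L(G)$ denote the set (lattice) of all subgroups of $G$, including the trivial subgroup and $G$ itself, and define $\sigma_1(G)=\sum_{H\in L(G)}\frac{|H|}{|G|}=\sum_{H\in L(G)}\frac{1}{|G:H|}$. *)

(* Defs.v *)
From HB Require Import structures.
From mathcomp Require Import all_boot all_order all_algebra all_fingroup all_solvable.
From mathcomp Require Import all_classical all_reals all_analysis.

Set Implicit Arguments.
Unset Strict Implicit.
Unset Printing Implicit Defensive.

Import Order.TTheory GRing.Theory Num.Theory.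
Local Open Scope ring_scope.

Definition sigma1 (R : realType) (gT : finGroupType) (G : {group gT}) : R :=
  \sum_(H in subgroups G) #|H|%:R / #|G|%:R.

(* Main.v *)
Require Import Defs.
From HB Require Import structures.
From mathcomp Require Import all_boot all_order all_algebra all_fingroup all_solvable.
From mathcomp Require Import finfield.
From mathcomp Require Import all_classical all_reals all_analysis.
From mathcomp Require Import ring zify.
Import Order.TTheory GRing.Theory Num.Theory.
Import numFieldNormedType.Exports.
Local Open Scope classical_set_scope.
Local Open Scope ring_scope.

(** Let [q < p] be primes and let [G] be a non-nilpotent group of order [p * q].
    By Sylow's theorem [G] has one subgroup of order [p] and, not being
    nilpotent, exactly [p] subgroups of order [q]; the only other subgroups are
    the trivial one and [G].  The [p] subgroups of order [q] have index [p], so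
    together they weigh exactly [1], as much as [G] itself, whence
    [sigma1 G = 1 + 1 + 1/q + 1/(p q)] ([sigma1_pq]).  This tends to [2] as [q]
    grows, whatever [p] is.

    For every prime [q] such a [G] exists ([pq_group_exists]).  If [p] is a prime
    divisor of [2 ^ q - 1], then [2] has order exactly [q] in the multiplicative
    group of the field with [p] elements, so [q] divides [p - 1]; the
    permutations [x |-> x + 1] and [x |-> 2 x] of this field generate a group of
    order [p * q], in which elements of the coprime orders [p] and [q] do not
    commute.

    Along an increasing sequence of primes [q], the values strictly decrease
    because [1/q' + 1/(p' q') <= 1/q] as soon as [q < q'] and [q <= p']
    ([ltr_invD_invM]). *)

(** * Non-nilpotent groups of order p q *)

Lemma unity_root_neq0 (F : fieldType) (a : F) (n : nat) :
  (0 < n)%N -> a ^+ n = 1 -> a != 0.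
Proof.
move=> n_gt0; apply: contra_eqN => /eqP->.
by rewrite expr0n eqn0Ngt n_gt0 eq_sym oner_eq0.
Qed.

(** The primality of [q] makes the order of [a] equal to [q], and this order
    divides that of the multiplicative group of the field. *)
Lemma prime_exponent_dvd_pred (p q : nat) (a : 'F_p) :
  prime p -> prime q -> a ^+ q = 1 -> a != 1 -> (q %| p.-1)%N.
Proof.
move=> p_pr q_pr aq1 a1.
have [m am m_dvd_q] := prim_order_exists (prime_gt0 q_pr) aq1.
have a0 := unity_root_neq0 _ _ _ (prime_gt0 q_pr) aq1.
have -> : q = m.
  move/primeP: q_pr => [_ /(_ m m_dvd_q)] /orP[|/eqP//] /eqP m1.
  by move: (prim_expr_order am) a1; rewrite m1 expr1 => ->; rewrite eqxx.
rewrite (prim_order_dvd am) -(inj_eq (mulIf a0)) mul1r -exprSr.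
by rewrite prednK ?prime_gt0 // -[X in _ ^+ X](card_Fp p_pr) expf_card.
Qed.

(** The group is generated by the translation [x |-> x + 1] and the homothety
    [x |-> x * a].  The latter normalises the former and their orders [p] and [q]
    are coprime, which gives the order of the group.  In a nilpotent group,
    subgroups of coprime orders centralise each other, but these two permutations
    send [0] to [a] or to [1] according to the order in which they are composed. *)
Lemma affine_subgroup (p q : nat) (a : 'F_p) :
    prime p -> prime q -> a ^+ q = 1 -> a != 1 ->
  exists G : {group {perm 'F_p}}, #|G| = (p * q)%N /\ ~~ nilpotent G.
Proof.
move=> p_pr q_pr aq1 a1.
have a0 := unity_root_neq0 _ _ _ (prime_gt0 q_pr) aq1.
pose t : {perm 'F_p} := perm (addIr 1).
pose m : {perm 'F_p} := perm (mulIf a0).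
have tX k x : (t ^+ k)%g x = x + k%:R.
  rewrite permX; elim: k => [|k IHk] /=; first by rewrite addr0.
  by rewrite IHk permE -addrA natr1.
have mX k x : (m ^+ k)%g x = x * a ^+ k.
  rewrite permX; elim: k => [|k IHk] /=; first by rewrite mulr1.
  by rewrite IHk permE -mulrA exprSr.
have tx x : t x = x + 1 by rewrite permE.
have mx x : m x = x * a by rewrite permE.
have prime_order (s : {perm 'F_p}) r x :
    prime r -> (s ^+ r)%g = 1%g -> s x != x -> #[s]%g = r.
  move=> r_pr sr1 sx; apply: nt_prime_order => //.
  by apply: contraNneq sx => ->; rewrite perm1.
have ot : #[t]%g = p.
  apply: (@prime_order _ _ 0) => //.
    by apply/permP=> x; rewrite tX perm1 pchar_Fp_0 // addr0.
  by rewrite tx add0r oner_eq0.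
have om : #[m]%g = q.
  apply: (@prime_order _ _ 1) => //; last by rewrite mx mul1r.
  by apply/permP=> x; rewrite mX perm1 aq1 mulr1.
have tm : (t ^ m = t ^+ (a : nat))%g.
  apply: (mulgI m); rewrite -conjgC.
  by apply/permP=> x; rewrite !permM tx mx tX mx natr_Zp mulrDl mul1r.
have nTM : (<[m]> \subset 'N(<[t]>))%g.
  by rewrite cycle_subG inE -cycleJ cycle_subG /= tm mem_cycle.
have cop : coprime #|<[t]>%g| #|<[m]>%g|.
  rewrite -!orderE ot om prime_coprime //.
  (* [q = p] would make [p] divide [p - 1]. *)
  apply: contraTN (prime_exponent_dvd_pred _ _ _ p_pr q_pr aq1 a1).
  rewrite dvdn_prime2 // => /eqP<-; have := prime_gt1 p_pr.
  by case: (p) => [|[|k]] // _; rewrite gtnNdvd.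
exists (<[t]> <*> <[m]>)%G; split.
  by rewrite /= norm_joinEr // coprime_cardMg // -!orderE ot om.
apply: contra a1 => nilG.
have := sub_nilpotent_cent2 nilG (joing_subl _ _) (joing_subr _ _) cop.
rewrite centsC cent_cycle cycle_subG => /cent1P tm_comm.
have := congr1 (fun s : {perm _} => s 0) tm_comm.
by rewrite !permM !tx !mx mul0r add0r mul1r => ->.
Qed.

(** A prime divisor [p] of [2 ^ q - 1] is one for which [2] is a nontrivial
    [q]-th root of unity modulo [p]; then [q %| p.-1] also yields [q < p].
    The group is packed with its ambient type so that the axiom of choice can
    select both at once, for a whole sequence of primes [q]. *)
Lemma pq_group_exists (q : nat) : prime q ->
  exists (p : nat) (K : {gT : finGroupType & {group gT}}),
    [/\ prime p, (q < p)%N, #|tagged K| = (p * q)%N & ~~ nilpotent (tagged K)].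
Proof.
move=> q_pr; have q_gt1 := prime_gt1 q_pr.
have M_gt1 : (1 < 2 ^ q - 1)%N.
  by rewrite ltn_subRL (@leq_trans (2 ^ 2)) // leq_exp2l.
pose p := pdiv (2 ^ q - 1); have p_pr : prime p by apply: pdiv_prime.
have twoq : (2 : 'F_p) ^+ q = 1.
  apply/eqP; rewrite -natrX -subr_eq0 -[X in _ - X]/(1%:R) -natrB ?expn_gt0 //.
  by rewrite -(dvdn_pcharf (pchar_Fp p_pr)) pdiv_dvd.
have two1 : (2 : 'F_p) != 1.
  by rewrite -subr_eq0 -[2]natr1 addrK oner_eq0.
have [G [oG nilG]] := affine_subgroup _ _ _ p_pr q_pr twoq two1.
exists p, (existT _ _ G); split=> //.
have := dvdn_leq _ (prime_exponent_dvd_pred _ _ _ p_pr q_pr twoq two1).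
have := prime_gt1 p_pr; lia.
Qed.

(** * Their subgroups *)

Lemma partn_pq (p q : nat) : prime p -> prime q -> (q < p)%N ->
  ((p * q)`_p = p)%N /\ ((p * q)`_q = q)%N.
Proof.
move=> p_pr q_pr ltqp; have [p_gt0 q_gt0] := (prime_gt0 p_pr, prime_gt0 q_pr).
split; rewrite partnM //.
  rewrite part_pnat_id ?pnat_id // part_p'nat ?muln1 //.
  by rewrite pnatE // !inE neq_ltn ltqp.
rewrite part_p'nat ?mul1n ?part_pnat_id ?pnat_id //.
by rewrite pnatE // !inE neq_ltn ltqp orbT.
Qed.

Lemma coprime_primes_lt (p q : nat) :
  prime p -> prime q -> (q < p)%N -> coprime p q.
Proof. by move=> p_pr q_pr ltqp; rewrite prime_coprime // gtnNdvd ?prime_gt0. Qed.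

Lemma mem_Syl_pq (p q : nat) (gT : finGroupType) (G H : {group gT}) :
    prime p -> prime q -> (q < p)%N -> #|G| = (p * q)%N ->
  (H \in 'Syl_p(G)%g) = (H \subset G) && (#|H| == p) /\
  (H \in 'Syl_q(G)%g) = (H \subset G) && (#|H| == q).
Proof.
move=> p_pr q_pr ltqp oG; have [partp partq] := partn_pq _ _ p_pr q_pr ltqp.
by split; rewrite inE pHallE oG ?partp ?partq.
Qed.

Lemma card_Syl_pq_large (p q : nat) (gT : finGroupType) (G : {group gT}) :
    prime p -> prime q -> (q < p)%N -> #|G| = (p * q)%N ->
  #|'Syl_p(G)%g| = 1%N.
Proof.
move=> p_pr q_pr ltqp oG.
have := card_Syl_mod G p_pr; have := card_Syl_dvd p G.
rewrite oG; set n := #|_| => n_dvd n_mod.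
have n_dvdq : (n %| q)%N.
  rewrite -(@Gauss_dvdr n p q) // coprime_sym prime_coprime //.
  by apply/negP => /eqP pn; rewrite n_mod in pn.
by rewrite -n_mod modn_small // (leq_ltn_trans _ ltqp) // dvdn_leq ?prime_gt0.
Qed.

(** The number of [q]-Sylow subgroups divides [p].  If it were [1], both Sylow
    subgroups would be normal, so that the Fitting subgroup would contain them
    and hence be all of [G]. *)
Lemma card_Syl_pq_small (p q : nat) (gT : finGroupType) (G : {group gT}) :
    prime p -> prime q -> (q < p)%N -> #|G| = (p * q)%N -> ~~ nilpotent G ->
  #|'Syl_q(G)%g| = p.
Proof.
move=> p_pr q_pr ltqp oG nilG.
have nSylp := card_Syl_pq_large _ _ _ _ p_pr q_pr ltqp oG.
have cop_pq := coprime_primes_lt _ _ p_pr q_pr ltqp.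
have [partp partq] := partn_pq _ _ p_pr q_pr ltqp; rewrite -oG in partp partq.
have := card_Syl_mod G q_pr; have := card_Syl_dvd q G.
rewrite oG; set n := #|_| => n_dvd n_mod.
have n_dvdp : (n %| p)%N.
  rewrite -(@Gauss_dvdl n p q) // coprime_sym prime_coprime //.
  by apply/negP => /eqP qn; rewrite n_mod in qn.
move/primeP: p_pr => [_ /(_ n n_dvdp)] /orP[|/eqP//] /eqP n1.
case/negP: nilG.
have subF (r : nat) : #|'Syl_r(G)%g| = 1%N -> ((#|G|)`_r %| #|'F(G)%g|)%N.
  move/eqP/normal_sylowP => [P sylP nPG]; rewrite -(card_Hall sylP).
  by apply/cardSg/(Fitting_max nPG)/(pgroup_nil (pHall_pgroup sylP)).
suff <- : 'F(G)%g = G by apply: Fitting_nil.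
apply/eqP; rewrite eqEcard Fitting_sub dvdn_leq ?cardG_gt0 // oG.
by rewrite Gauss_dvd // -{1}partp -{1}partq !subF.
Qed.

Lemma subgroups_pq (p q : nat) (gT : finGroupType) (G : {group gT}) :
    prime p -> prime q -> (q < p)%N -> #|G| = (p * q)%N ->
  subgroups G = 1%G |: (G |: ('Syl_p(G)%g :|: 'Syl_q(G)%g)).
Proof.
move=> p_pr q_pr ltqp oG; have p_gt0 := prime_gt0 p_pr.
apply/setP => H; rewrite 2!in_setU1 finset.in_setU.
have [-> ->] := mem_Syl_pq _ _ _ _ H p_pr q_pr ltqp oG.
rewrite inE.
have [-> | H1] := eqVneq H 1%G; first by rewrite sub1G.
have [-> | HG] := eqVneq H G; first by rewrite subxx.
case sHG: (H \subset G) => //=.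
have := cardSg sHG; rewrite oG; case: (boolP (p %| #|H|)%N) => [/dvdnP[k Hk]|pH].
  rewrite Hk mulnC dvdn_pmul2l // => kq; case/primeP: q_pr => _ /(_ k kq).
  case/orP => /eqP k1; first by rewrite k1 muln1 eqxx.
  case/eqP: HG; apply/val_inj/eqP; rewrite eqEcard sHG /=.
  by rewrite oG Hk k1 mulnC.
rewrite Gauss_dvdr 1?coprime_sym ?prime_coprime // => Hq.
case/primeP: q_pr => _ /(_ _ Hq) /orP[|->]; last by rewrite orbT.
by rewrite -trivg_card1 => /eqP H1'; case/eqP: H1; apply: val_inj.
Qed.

Lemma sigma1_pq (R : realType) (p q : nat) (gT : finGroupType) (G : {group gT}) :
    prime p -> prime q -> (q < p)%N -> #|G| = (p * q)%N -> ~~ nilpotent G ->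
  sigma1 R G = 2 + q%:R^-1 + (p * q)%:R^-1.
Proof.
move=> p_pr q_pr ltqp oG nilG.
have [p_gt1 q_gt1] := (prime_gt1 p_pr, prime_gt1 q_pr).
have p_gt0 := ltnW p_gt1; have q_gt0 := ltnW q_gt1.
have memSyl H := mem_Syl_pq _ _ _ _ H p_pr q_pr ltqp oG.
have memp H := (memSyl H).1; have memq H := (memSyl H).2.
have disj : [disjoint 'Syl_p(G)%g & 'Syl_q(G)%g]%B.
  apply/pred0P => H /=; rewrite memp memq; apply/negP.
  case/andP => /andP[_ /eqP->] /andP[_ /eqP pq].
  by rewrite pq ltnn in ltqp.
rewrite /sigma1 (subgroups_pq p q) // big_setU1 ?big_setU1 /=.
- rewrite (eq_bigl _ _ (fun H => finset.in_setU H _ _)) bigU //=.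
  rewrite (eq_bigr (fun=> q%:R^-1)); last first.
    move=> H; rewrite memp => /andP[_ /eqP->]; rewrite oG natrM invfM mulrA.
    by rewrite divff ?mul1r // pnatr_eq0 -lt0n.
  rewrite [X in _ + (_ + (_ + X))](eq_bigr (fun=> p%:R^-1)); last first.
    move=> H; rewrite memq => /andP[_ /eqP->]; rewrite oG mulnC natrM invfM mulrA.
    by rewrite divff ?mul1r // pnatr_eq0 -lt0n.
  rewrite !sumr_const (card_Syl_pq_large p q) // (card_Syl_pq_small p q) //.
  rewrite cards1 oG divff; last first.
    by rewrite pnatr_eq0 -lt0n muln_gt0 p_gt0.
  rewrite mulr1n -[_ *+ p]mulr_natr mulVf ?pnatr_eq0 -?lt0n // mul1r.
  by ring.
(* The order distinguishes [G] and the trivial group from the Sylow subgroups. *)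
- rewrite finset.in_setU memp memq oG subxx /=.
  by rewrite -{2}[p]muln1 -{3}[q]mul1n eqn_pmul2l // eqn_pmul2r // !gtn_eqF.
- rewrite in_setU1 finset.in_setU memp memq sub1G cards1 /= !ltn_eqF // !orbF.
  rewrite -val_eqE /= eq_sym trivg_card1 oG muln_eq1.
  by rewrite gtn_eqF.
Qed.

(** * Monotonicity and the limit *)

(** The left-hand side is at most [(1 + a^-1) / b], and [1 + a^-1 = (a + 1) / a]
    where [a + 1 <= b], so that [a^-1] already separates the two sides. *)
Lemma ltr_invD_invM (F : realFieldType) (a b c d : nat) :
    (0 < a)%N -> (a < b)%N -> (0 < c)%N -> (a <= d)%N ->
  b%:R^-1 + (d * b)%:R^-1 < a%:R^-1 + (c * a)%:R^-1 :> F.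
Proof.
move=> a_gt0 ltab c_gt0 lead.
have a_pos : 0 < a%:R :> F by rewrite ltr0n.
have b_pos : 0 < b%:R :> F by rewrite ltr0n (ltn_trans a_gt0).
apply: (@le_lt_trans _ _ a%:R^-1); last first.
  by rewrite ltrDl invr_gt0 ltr0n muln_gt0 c_gt0.
apply: (@le_trans _ _ (b%:R^-1 * (a%:R + 1) / a%:R)).
  rewrite mulrDr mulr1 mulrDl mulfK ?gt_eqF // lerD2l natrM invfM mulrC.
  by rewrite ler_pM2l ?invr_gt0 // lef_pV2 ?posrE ?ltr0n ?(leq_trans a_gt0) // ler_nat.
by rewrite ler_piMl ?invr_ge0 ?ler0n // mulrC ler_pdivrMr // mul1r natr1 ler_nat.
Qed.

Theorem theorem3 (R : realType) :
  exists (gT : nat -> finGroupType) (G : forall n : nat, {group (gT n)}),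
    [/\ forall n : nat, ~~ nilpotent (G n),
        decreasing_seq (fun n : nat => sigma1 R (G n)) &
        (fun n : nat => sigma1 R (G n)) @ \oo --> (2 : R)].
Proof.
(* Euclid: a prime factor of [n`! + 1] exceeds [n]. *)
pose q := fix q n := if n is n'.+1 then pdiv ((q n')`!.+1) else 2%N.
have q_pr n : prime (q n) by case: n => //= n; rewrite pdiv_prime // ltnS fact_gt0.
have q_lt n : (q n < q n.+1)%N.
  rewrite /= ltnNge; apply/negP => le_q.
  have := pdiv_dvd (q n)`!.+1; rewrite -addn1 dvdn_addr ?addn1.
    by rewrite dvdn1 => /eqP d1; have := q_pr n.+1; rewrite /= d1.
  by apply: dvdn_fact; rewrite pdiv_gt0.
have [p exK] := choice (fun n => pq_group_exists _ (q_pr n)).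
have [K Kpq] := choice exK.
have sE n : sigma1 R (tagged (K n)) = 2 + (q n)%:R^-1 + (p n * q n)%:R^-1.
  by have [p_pr lt_qp oK nK] := Kpq n; apply: sigma1_pq.
exists (fun n => tag (K n)), (fun n => tagged (K n)); split.
- by move=> n; have [] := Kpq n.
- apply/decreasing_seqP => n; rewrite !sE.
  have [p_pr _ _ _] := Kpq n; have [_ lt_qp' _ _] := Kpq n.+1.
  rewrite -addrA -[X in _ < X]addrA ltrD2l; apply: ltr_invD_invM; rewrite ?prime_gt0 //.
  exact/ltnW/(ltn_trans (q_lt n)).
- under eq_fun do rewrite sE.
  have q_gt n : (n < q n)%N by elim: n => [//|n IHn]; apply: leq_ltn_trans (q_lt n).
  have invq0 : (fun n => (q n)%:R^-1 : R) @ \oo --> 0.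
    apply: (@squeeze_cvgr _ _ _ _ (fun=> 0) harmonic); last exact: cvg_harmonic.
      apply: nearW => n; rewrite invr_ge0 ler0n /=.
      by rewrite lef_pV2 ?ler_nat // posrE ltr0n // prime_gt0.
    exact: cvg_cst.
  have invpq0 : (fun n => (p n * q n)%:R^-1 : R) @ \oo --> 0.
    apply: (@squeeze_cvgr _ _ _ _ (fun=> 0) (fun n => (q n)%:R^-1)) invq0.
      apply: nearW => n; have [p_pr _ _ _] := Kpq n; rewrite invr_ge0 ler0n /=.
      by rewrite lef_pV2 ?ler_nat ?leq_pmull ?posrE ?ltr0n ?muln_gt0 ?prime_gt0.
    exact: cvg_cst.
  have : (fun n => (2 : R) + (q n)%:R^-1 + (p n * q n)%:R^-1) @ \oo --> (2 : R) + 0 + 0.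
    by apply: cvgD invpq0; apply: cvgD invq0; apply: cvg_cst.
  by rewrite !addr0.
Qed.
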